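(* Let $G=\mathbb{R}^{2n+m}$ be an H-type group. A path $(x(t),z(t))$, $t\in[0,1]$, in $G$ is the projection of a solution $(x(t),z(t),\xi(t),\eta(t))$ of Hamilton's equations with $x(0)=0$, $z(0)=0$ and with given endpoint $x(1),z(1)$ if and only if: 1. If $z(1)=0$: $x(t)=t\,x(1)$ and $z(t)=0$. 2. If $z(1)\ne0$: $$x(t)=\frac1{|\eta_0|^2}J_{\eta_0}(I-e^{tJ_{\eta_0}})\xi_0,\qquad z(t)=\frac{|\xi_0|^2}{2|\eta_0|^3}\big(|\eta_0|t-\sin(|\eta_0|t)\big)\eta_0,$$ where: (a) if $x(1)\ne0$, then $$\eta_0=2\theta\,\frac{z(1)}{|z(1)|},\qquad \xi_0=-|\eta_0|^2\big(J_{\eta_0}(e^{J_{\eta_0}}-I)\big)^{-1}x(1),$$ for some solution $\theta$ of $\nu(\theta)=\dfrac{4|z(1)|}{|x(1)|^2}$; (b) if $x(1)=0$, then $\eta_0=2\pi k\,\dfrac{z(1)}{|z(1)|}$ and $\xi_0\in\mathbb{R}^{2n}$ is a vector with $|\xi_0|=\sqrt{4k\pi|z(1)|}$, for some integer $k\ge1$.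
   Context: H-type groups. A finite-dimensional real Lie algebra $\mathfrak g$ with center $\mathfrak z$ is an H-type Lie algebra under an inner product $\langle\cdot,\cdot\rangle$ if $[\mathfrak z^\perp,\mathfrak z^\perp]=\mathfrak z$ and, for each $z\in\mathfrak z$ with $|z|=1$, the map $J_z:\mathfrak z^\perp\to\mathfrak z^\perp$ defined by $\langle J_z x,y\rangle=\langle z,[x,y]\rangle$ is orthogonal. An H-type group is a connected, simply connected Lie group whose Lie algebra is H-type. Every such group is realized as $G=\mathbb{R}^{2n+m}$ ($n,m\ge1$), with elements $(x,z)$, $x\in\mathbb{R}^{2n}$, $z\in\mathbb{R}^m$, where $(\mathbb{R}^{2n+m},[\cdot,\cdot])$ is an H-type Lie algebra under the Euclidean inner product with center $\{0\}\times\mathbb{R}^m$, the bracket is regarded as a map $\mathbb{R}^{2n}\times\mathbb{R}^{2n}\to\mathbb{R}^m$, and the group law is $(x,z)\star(x',z')=(x+x',\,z+z'+\frac12[x,x'])$. Thus $J_\eta$ ($\eta\in\mathbb{R}^m$) is the linear map on $\mathbb{R}^{2n}$ with $\langle J_\eta x,y\rangle=\langle\eta,[x,y]\rangle$. Hamilton's equations. Use coordinates $(x,z,\xi,\eta)\in\mathbb{R}^{2n}\times\mathbb{R}^m\times\mathbb{R}^{2n}\times\mathbb{R}^m$ on $T^*G$, representing the covector $\sum_i\xi_idx^i+\sum_j\eta_jdz^j$ at $(x,z)$. The subriemannian Hamiltonian is $H=\frac12|\xi+\frac12J_\eta x|^2$, and Hamilton's equations of motion are $$\dot x=\xi+\tfrac12J_\eta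 x,\quad \dot z=\tfrac14|x|^2\eta+\tfrac12[x,\xi],\quad \dot\xi=-\tfrac14|\eta|^2x+\tfrac12J_\eta\xi,\quad \dot\eta=0.$$ The projection of $(x,z,\xi,\eta)$ is $(x,z)$. The function $\nu$ is $\nu(\theta)=\dfrac{2\theta-\sin2\theta}{1-\cos2\theta}=\dfrac{\theta}{\sin^2\theta}-\cot\theta$, with $\nu(0)=0$ by continuity (undefined at nonzero integer multiples of $\pi$). *)

(* Defs.v *)
From HB Require Import structures.
From mathcomp Require Import all_boot all_order all_algebra.
From mathcomp Require Import all_classical all_reals all_analysis.
Set Implicit Arguments.
Unset Strict Implicit.
Unset Printing Implicit Defensive.
Import Order.TTheory GRing.Theory Num.Theory.
Import numFieldNormedType.Exports.
Local Open Scope classical_set_scope.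
Local Open Scope ring_scope.

Section Euclidean.
Context {R : realType} {p : nat}.
Implicit Types u v : 'cV[R]_p.

Definition dot u v : R := \sum_i u i 0 * v i 0.

(* The library norm on matrices is the sup norm. *)
Definition enorm v : R := Num.sqrt (dot v v).

Definition orthc (A : set 'cV[R]_p) : set 'cV[R]_p :=
  [set v | forall u, A u -> dot u v = 0].

End Euclidean.

(* The (i, j) entry is forced by <J_z e_j, e_i> = <z, [e_j, e_i]>; see JmxP. *)
Definition Jmx {R : realType} {p q : nat}
    (b : 'cV[R]_p -> 'cV[R]_p -> 'cV[R]_q) (z : 'cV[R]_q) : 'M[R]_p :=
  \matrix_(i, j) dot z (b (delta_mx j 0) (delta_mx i 0)).

Section LieAlgebra.
Context {R : realType} {N : nat}.
Variable b : 'cV[R]_N -> 'cV[R]_N -> 'cV[R]_N.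

Definition is_Lie_bracket : Prop :=
  [/\ (forall u, linear (b u)),
      (forall v, linear (b ^~ v)),
      (forall u, b u u = 0) &
      (forall u v w, b u (b v w) + b v (b w u) + b w (b u v) = 0)].

Definition Lie_center : set 'cV[R]_N := [set v | forall u, b v u = 0].

(* [A, B], the linear span of the brackets. *)
Definition bracket_span (A B : set 'cV[R]_N) : set 'cV[R]_N :=
  [set v | exists s : seq (R * ('cV[R]_N * 'cV[R]_N)),
     (forall c, c \in s -> A c.2.1 /\ B c.2.2) /\
     v = \sum_(c <- s) c.1 *: b c.2.1 c.2.2].

(* For central z, [Jmx b z] maps the whole algebra into the orthogonal
   complement of the center (Jmx_orthc), where it restricts to J_z; that the
   restriction is orthogonal means that it preserves inner products. *)
Definition Htype_Lie_algebra : Prop :=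
  [/\ is_Lie_bracket,
      bracket_span (orthc Lie_center) (orthc Lie_center) = Lie_center &
      forall z, Lie_center z -> enorm z = 1 ->
        forall x y, orthc Lie_center x -> orthc Lie_center y ->
          dot (Jmx b z *m x) (Jmx b z *m y) = dot x y].

End LieAlgebra.

(* The bracket of an H-type Lie algebra structure on R^(2n+m) whose center is
   {0} x R^m; elements (x, z) are written [col_mx x z]. *)
Definition Htype_group {R : realType} (n m : nat)
    (b : 'cV[R]_(2 * n + m) -> 'cV[R]_(2 * n + m) -> 'cV[R]_(2 * n + m)) :
    Prop :=
  [/\ (0 < n)%N, (0 < m)%N, Htype_Lie_algebra b &
      Lie_center b = [set v | usubmx v = 0]].

(* The bracket regarded as a map R^(2n) x R^(2n) -> R^m. *)
Definition hbracket {R : realType} {n m : nat}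
    (b : 'cV[R]_(2 * n + m) -> 'cV[R]_(2 * n + m) -> 'cV[R]_(2 * n + m))
    (x y : 'cV[R]_(2 * n)) : 'cV[R]_m :=
  dsubmx (b (col_mx x 0) (col_mx y 0)).

(* G is R^(2n+m) with this group law; only the bracket enters Hamilton's
   equations below. *)
Definition Htype_mul {R : realType} {n m : nat}
    (b : 'cV[R]_(2 * n + m) -> 'cV[R]_(2 * n + m) -> 'cV[R]_(2 * n + m))
    (g h : 'cV[R]_(2 * n + m)) : 'cV[R]_(2 * n + m) :=
  col_mx (usubmx g + usubmx h)
    (dsubmx g + dsubmx h + 2^-1 *: hbracket b (usubmx g) (usubmx h)).

(* Derivative at t relative to [0, 1]: one-sided at the endpoints. *)
Definition is_derive01 {R : realType} {p : nat} (f : R -> 'cV[R]_p) (t : R)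
    (l : 'cV[R]_p) : Prop :=
  (s - t)^-1 *: (f s - f t) @[s --> within (`[0, 1] `\ t) (nbhs t)] --> l.

(* Hamilton's equations on [0, 1] for H = |xi + J_eta x / 2|^2 / 2. *)
Definition Hamilton_solution {R : realType} {n m : nat}
    (b : 'cV[R]_(2 * n + m) -> 'cV[R]_(2 * n + m) -> 'cV[R]_(2 * n + m))
    (x : R -> 'cV[R]_(2 * n)) (z : R -> 'cV[R]_m)
    (xi : R -> 'cV[R]_(2 * n)) (eta : R -> 'cV[R]_m) : Prop :=
  forall t : R, 0 <= t <= 1 ->
    let J := Jmx (hbracket b) (eta t) in
    [/\ is_derive01 x t (xi t + 2^-1 *: (J *m x t)),
        is_derive01 z t ((4^-1 * enorm (x t) ^+ 2) *: eta t
                         + 2^-1 *: hbracket b (x t) (xi t)),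
        is_derive01 xi t (- (4^-1 * enorm (eta t) ^+ 2) *: x t
                          + 2^-1 *: (J *m xi t)) &
        is_derive01 eta t 0].

(* The entrywise limit of the exponential series; it exists for every A. *)
Definition expmx {R : realType} {p : nat} (A : 'M[R]_p) : 'M[R]_p :=
  lim (series (fun k => (k`!%:R)^-1 *: A ^+ k) @ \oo).

Section Nu.
Context {R : realType}.

Definition nu_defined (theta : R) : Prop :=
  forall k : int, k != 0 -> theta != k%:~R * pi.

Definition nu (theta : R) : R :=
  if theta == 0 then 0
  else (2 * theta - sin (2 * theta)) / (1 - cos (2 * theta)).

End Nu.

Section JmxTheory.
Context {R : realType}.

Lemma dotC p (u v : 'cV[R]_p) : dot u v = dot v u.
Proof. by apply: eq_bigr => i _; rewrite mulrC. Qed.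

Lemma dot_linear p (u : 'cV[R]_p) : scalar (dot u).
Proof.
move=> a v w; rewrite /dot mulr_sumr -big_split /=; apply: eq_bigr => i _.
by rewrite !mxE mulrDr mulrCA.
Qed.

Lemma col_sum_delta p (x : 'cV[R]_p) : x = \sum_i x i 0 *: delta_mx i 0.
Proof. by rewrite {1}[x]matrix_sum_delta; under eq_bigr do rewrite big_ord1. Qed.

Lemma scalar_sum (p : nat) (f : 'cV[R]_p -> R) (x : 'cV[R]_p) : scalar f ->
  f x = \sum_i x i 0 * f (delta_mx i 0).
Proof.
move=> lf; have f0 : f 0 = 0.
  have := lf 1 0 0; rewrite scaler0 addr0 mul1r => /eqP.
  by rewrite -subr_eq0 opprD addrA subrr add0r oppr_eq0 => /eqP.
rewrite {1}[x]col_sum_delta; elim/big_rec2: _ => // i y1 y2 _ <-.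
exact: lf.
Qed.

Lemma JmxP p q (b : 'cV[R]_p -> 'cV[R]_p -> 'cV[R]_q) z x y :
  (forall u, linear (b u)) -> (forall v, linear (b ^~ v)) ->
  dot (Jmx b z *m x) y = dot z (b x y).
Proof.
move=> br bl; pose f v := dot z (b x v); pose g i v := dot z (b v (delta_mx i 0)).
have lf : scalar f by move=> a u v; rewrite /f br dot_linear.
have lg i : scalar (g i) by move=> a u v; rewrite /g bl dot_linear.
rewrite -[RHS]/(f y) (scalar_sum y lf); apply: eq_bigr => i _.
rewrite mulrC -[f _]/(g i x) (scalar_sum x (lg i)) mxE; congr (_ * _).
by apply: eq_bigr => j _; rewrite mxE mulrC.
Qed.

Lemma Jmx_orthc N (b : 'cV[R]_N -> 'cV[R]_N -> 'cV[R]_N) z x :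
  is_Lie_bracket b -> orthc (Lie_center b) (Jmx b z *m x).
Proof.
move=> [br bl alt _] u cu; rewrite dotC JmxP //.
have lin0 (f : 'cV[R]_N -> R) : scalar f -> f 0 = 0.
  by move=> lf; rewrite (scalar_sum 0 lf) big1 // => i _; rewrite mxE mul0r.
suff -> : b x u = 0 by apply: lin0; exact: dot_linear.
have := alt (x + u).
have -> : b (x + u) (x + u) = b x x + b x u + (b u x + b u u).
  have D v w1 w2 : b v (w1 + w2) = b v w1 + b v w2.
    by have := br v 1 w1 w2; rewrite !scale1r.
  by have := bl (x + u) 1 x u; rewrite !scale1r /= => ->; rewrite !D.
by rewrite !alt add0r addr0 cu addr0.
Qed.

End JmxTheory.

(* Main.v *)
(* Put v = dx/dt = xi + J x / 2. Along a solution eta is constant and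
   dv/dt = J v, where J^2 = - |eta|^2 in an H-type algebra, so v = exp(tJ) xi0
   with exp(tJ) = cos(|eta| t) + (sin(|eta| t) / |eta|) J. Moreover
   dz/dt = [x, v] / 2, and [y, J y] = |y|^2 eta makes this a multiple of eta;
   integrating gives x(t) and z(t), hence
     |x(1)|^2 = 2 (1 - cos |eta|) |xi0|^2 / |eta|^2,
     |z(1)| = (|eta| - sin |eta|) |xi0|^2 / (2 |eta|^2).
   If x(1) <> 0, the quotient of the two is nu(|eta| / 2) / 4; if x(1) = 0 and
   z(1) <> 0, then cos |eta| = 1. *)
Require Import Defs.
From mathcomp Require Import all_boot all_order all_algebra.
From mathcomp Require Import all_classical all_reals all_analysis.
From mathcomp Require Import ring lra.
Set Implicit Arguments.
Unset Strict Implicit.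
Unset Printing Implicit Defensive.
Import Order.TTheory GRing.Theory Num.Theory.
Import numFieldNormedType.Exports.
Local Open Scope classical_set_scope.
Local Open Scope ring_scope.

(** * Calculus on [0, 1] with one-sided derivatives at the endpoints *)

Section Derive01.
Context {R : realType}.

Definition dnbhs01 (t : R) : set_system R := within (`[0, 1] `\ t) (nbhs t).

#[local] Instance dnbhs01_filter t : Filter (dnbhs01 t).
Proof. exact: within_filter. Qed.

(* [is_derive01] with values in an arbitrary normed module. *)
Definition derive01 {V : normedModType R} (f : R -> V) (t : R) (l : V) : Prop :=
  (s - t)^-1 *: (f s - f t) @[s --> dnbhs01 t] --> l.

Lemma cvg01_ext (V : normedModType R) (f g : R -> V) (t : R) (l : V) :
  (forall s, 0 <= s <= 1 -> s != t -> f s = g s) ->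
  f s @[s --> dnbhs01 t] --> l -> g s @[s --> dnbhs01 t] --> l.
Proof.
move=> fg; apply: cvg_trans; apply: near_eq_cvg.
rewrite near_withinE; apply: nearW => s; rewrite /= in_itv /= => -[s01 /eqP st].
by rewrite fg.
Qed.

Lemma derive01_ext (V : normedModType R) (f g : R -> V) t l :
  0 <= t <= 1 -> (forall s, 0 <= s <= 1 -> f s = g s) ->
  derive01 f t l -> derive01 g t l.
Proof. by move=> t01 fg; apply: cvg01_ext => s s01 _; rewrite !fg. Qed.

Lemma derive01_cst (V : normedModType R) (v : V) t : derive01 (fun=> v) t 0.
Proof.
rewrite /derive01; under eq_fun do rewrite subrr scaler0.
exact: cvg_cst.
Qed.

(** Write f s as (s - t) times the difference quotient plus f t: the first term tends to 0 times
    l. *)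
Lemma derive01_cvg (V : normedModType R) (f : R -> V) t l :
  derive01 f t l -> f s @[s --> dnbhs01 t] --> f t.
Proof.
move=> df.
apply: (@cvg01_ext _ (fun s => (s - t) *: ((s - t)^-1 *: (f s - f t)) + f t)).
  by move=> s _ st; rewrite scalerA divff ?subr_eq0// scale1r subrK.
rewrite -[f t in X in _ --> X]add0r -(scale0r l) -(subrr t).
apply: cvgD; last exact: cvg_cst.
apply: cvgZ df; apply: cvgB; last exact: cvg_cst.
exact: cvg_within.
Qed.

Lemma derive01D (V : normedModType R) (f g : R -> V) t a c :
  derive01 f t a -> derive01 g t c -> derive01 (fun s => f s + g s) t (a + c).
Proof.
move=> df dg; rewrite /derive01.
by under eq_fun do rewrite opprD addrACA scalerDr; exact: cvgD df dg.
Qed.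

(** Product rule: the quotient splits into (c s - c t)/(s - t) times f s plus c t times the quotient
    of f. The first part needs continuity of f at t, whence [derive01_cvg]. *)
Lemma derive01Z (V : normedModType R) (c : R -> R) (f : R -> V) t a l :
  derive01 c t a -> derive01 f t l ->
  derive01 (fun s => c s *: f s) t (a *: f t + c t *: l).
Proof.
move=> dc df.
apply: (@cvg01_ext _ (fun s => ((s - t)^-1 * (c s - c t)) *: f s
                       + c t *: ((s - t)^-1 *: (f s - f t)))).
  move=> s _ _; rewrite [c t *: _]scalerA [c t * _]mulrC -!scalerA -scalerDr.
  by rewrite scalerBl scalerBr subrKA.
apply: cvgD; first exact: cvgZ dc (derive01_cvg df).
by apply: cvgZ df; exact: cvg_cst.
Qed.

Lemma derive01_comp_linear (V W : normedModType R) (u : {linear V -> W})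
    (f : R -> V) t l :
  continuous u -> derive01 f t l -> derive01 (u \o f) t (u l).
Proof.
move=> cu df.
apply: (@cvg01_ext _ (u \o (fun s => (s - t)^-1 *: (f s - f t)))).
  by move=> s _ _; rewrite /= linearZ linearB.
exact: continuous_cvg (cu l) df.
Qed.

(** By Caratheodory's criterion the difference quotient extends to a function continuous at t with
    value l, and its limit persists along the smaller filter. *)
Lemma is_derive_derive01 (f : R -> R) (t l : R) : is_derive t 1 f l -> derive01 f t l.
Proof.
move=> /is_derive1_caratheodory [g [fE cg <-]].
apply: (@cvg01_ext _ g) => [s _ st|].
  by rewrite -[RHS]/((s - t)^-1 * (f s - f t)) fE mulrC mulfK// subr_eq0.
apply/cvgrPdist_lt => e e0; have /cvgrPdist_lt/(_ _ e0) := cg.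
by rewrite near_withinE; apply: filterS.
Qed.

(** At an interior point some neighborhood of t lies in [0, 1], so the restricted limit is the full
    one. The Caratheodory slope function is given the value l at t. *)
Lemma derive01_is_derive (f : R -> R) (t l : R) :
  0 < t < 1 -> derive01 f t l -> is_derive t 1 f l.
Proof.
move=> /andP[t0 t1] df; apply/is_derive1_caratheodory.
exists (fun s => if s == t then l else (s - t)^-1 * (f s - f t)); split.
- move=> s; case: eqP => [->|/eqP]; first by rewrite !subrr mulr0.
  by rewrite -subr_eq0 => st; rewrite mulrAC mulVf// mul1r.
- apply/cvgrPdist_lt => e e0; rewrite eqxx.
  have /cvgrPdist_lt/(_ _ e0) nf := df; rewrite near_withinE in nf.
  near=> s; case: eqP => [_|/eqP st]; first by rewrite subrr normr0.
  suff : (`[0, 1] `\ t) s by near: s; exact: nf.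
  split; last by apply/eqP.
  rewrite /= in_itv /=; apply/andP; split; apply: ltW; near: s.
    exact: lt_nbhsr.
  exact: lt_nbhsl.
- by rewrite /= eqxx.
Unshelve. all: by end_near. Qed.

(** The mean value theorem on [0, t]: it asks for ordinary derivatives only in the interior, and for
    mere continuity at the ends, where the derivative may be one-sided. *)
Lemma derive01_0_cst (f : R -> R) :
  (forall t, 0 <= t <= 1 -> derive01 f t 0) ->
  forall t, 0 <= t <= 1 -> f t = f 0.
Proof.
move=> df t /andP[]; rewrite le_eqVlt => /predU1P[<- //|t0] t1.
have fc : {within `[0, t], continuous f}.
  apply/subspace_continuousP => s; rewrite /= in_itv /= => /andP[s0 st].
  have /derive01_cvg fs : derive01 f s 0 by apply: df; rewrite s0 (le_trans st).
  apply/cvgrPdist_lt => e e0; have /cvgrPdist_lt/(_ _ e0) := fs.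
  rewrite !near_withinE; apply: filterS => u H; rewrite /= in_itv /= => /andP[u0 ut].
  have [->|/eqP us] := eqVneq u s; first by rewrite subrr normr0.
  by apply: H; split => //; rewrite /= in_itv /= u0 (le_trans ut).
have [s st|c _] := MVT t0 (df := fun=> 0) _ fc.
  move: st; rewrite in_itv /= => /andP[s0 st].
  have s1 : s < 1 by exact: lt_le_trans st t1.
  by apply: derive01_is_derive; rewrite ?s0//; apply: df; rewrite !ltW.
by rewrite mul0r => /eqP; rewrite subr_eq0 => /eqP.
Qed.

(** The map is a finite sum of coordinate functions times constant matrices. *)
Lemma mulmx_continuous (m n p : nat) (A : 'M[R]_(m, n)) :
  continuous (mulmx A : 'M[R]_(n, p) -> 'M[R]_(m, p)).
Proof.
have -> : (mulmx A : 'M[R]_(n, p) -> _) =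
    fun B => \sum_i \sum_j B i j *: (A *m delta_mx i j).
  apply/funext => B; rewrite {1}[B]matrix_sum_delta mulmx_sumr.
  apply: eq_bigr => i _; rewrite mulmx_sumr; apply: eq_bigr => j _.
  by rewrite -scalemxAr.
move=> B; rewrite /continuous_at.
apply: (@cvg_big _ _ _ _ _ _ _ (nbhs B)) => [|i _]; first exact: add_continuous.
apply: (@cvg_big _ _ _ _ _ _ _ (nbhs B)) => [|j _]; first exact: add_continuous.
by apply: cvgZr_tmp; exact: coord_continuous.
Qed.

Lemma derive01_mulmx (m n p : nat) (A : 'M[R]_(m, n)) (f : R -> 'M[R]_(n, p)) t l :
  derive01 f t l -> derive01 (fun s => A *m f s) t (A *m l).
Proof. exact: derive01_comp_linear (@mulmx_continuous m n p A). Qed.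

(** Taking an entry is continuous and linear, so the scalar case applies entry by entry. *)
Lemma derive01_mx_0_cst (m n : nat) (f : R -> 'M[R]_(m, n)) :
  (forall t, 0 <= t <= 1 -> derive01 f t 0) ->
  forall t, 0 <= t <= 1 -> f t = f 0.
Proof.
move=> df t t01; apply/matrixP => i j.
apply: (@derive01_0_cst (fun s => f s i j)) => // s s01.
have cij : {for 0, continuous (fun M : 'M[R]_(m, n) => M i j)}.
  exact: coord_continuous.
have := @continuous_cvg _ _ _ _ (dnbhs01_filter s) _ _ _ cij (df s s01).
by rewrite mxE; apply: cvg01_ext => u _ _; rewrite /= !mxE.
Qed.

Lemma derive01_eq (V : normedModType R) (f g : R -> V) (t : R) (l k : V) :
  f =1 g -> l = k -> derive01 f t l -> derive01 g t k.
Proof. by move=> /funext -> ->. Qed.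

Lemma derive01Zl (V : normedModType R) (c : R -> R) (v : V) (t a : R) :
  derive01 c t a -> derive01 (fun s => c s *: v) t (a *: v).
Proof. by move=> /derive01Z/(_ (derive01_cst v t)); rewrite scaler0 addr0. Qed.

Lemma derive01Zr (V : normedModType R) (c : R) (f : R -> V) (t : R) (l : V) :
  derive01 f t l -> derive01 (fun s => c *: f s) t (c *: l).
Proof. by move=> /(derive01Z (derive01_cst c t)); rewrite scale0r add0r. Qed.

Lemma derive01_id (t : R) : derive01 (fun s : R => s) t 1.
Proof. by apply: is_derive_derive01; exact: is_derive_id. Qed.

Lemma derive01_sin (w t : R) : derive01 (fun s => sin (w * s)) t (w * cos (w * t)).
Proof.
apply: is_derive_derive01; rewrite mulrC.
apply: (@is_derive1_comp _ sin ( *%R w)).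
by have := is_deriveZ w (is_derive_id t 1); rewrite -[_ *: 1]/(w * 1) mulr1.
Qed.

Lemma derive01_cos (w t : R) : derive01 (fun s => cos (w * s)) t (- (w * sin (w * t))).
Proof.
apply: is_derive_derive01; rewrite mulrC -mulNr.
apply: (@is_derive1_comp _ cos ( *%R w)).
by have := is_deriveZ w (is_derive_id t 1); rewrite -[_ *: 1]/(w * 1) mulr1.
Qed.

(** This is how the equations for x and z are integrated: the difference of two primitives has
    derivative 0 and vanishes at 0. *)
Lemma eq_derive01 (p : nat) (f g : R -> 'cV[R]_p) (l : R -> 'cV[R]_p) (t : R) :
  (forall s, 0 <= s <= 1 -> derive01 f s (l s)) ->
  (forall s, 0 <= s <= 1 -> derive01 g s (l s)) -> f 0 = g 0 ->
  0 <= t <= 1 -> f t = g t.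
Proof.
move=> df dg fg0 t01; apply/eqP; rewrite -subr_eq0 -scaleN1r; apply/eqP.
rewrite (@derive01_mx_0_cst _ _ (fun s => f s + (- 1) *: g s))//.
  by rewrite fg0 scaleN1r subrr.
move=> s s01; rewrite -(subrr (l s)) -[- l s]scaleN1r.
by apply: derive01D; [exact: df|apply: derive01Zr; exact: dg].
Qed.

End Derive01.

(** * The Euclidean inner product and norm *)

Section Dot.
Context {R : realType}.

Lemma dotDr p (u v w : 'cV[R]_p) : dot u (v + w) = dot u v + dot u w.
Proof. by have := dot_linear u 1 v w; rewrite scale1r mul1r. Qed.

Lemma dot0r p (u : 'cV[R]_p) : dot u 0 = 0.
Proof. by rewrite /dot big1 // => i _; rewrite mxE mulr0. Qed.

Lemma dotZr p (u v : 'cV[R]_p) a : dot u (a *: v) = a * dot u v.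
Proof. by rewrite -[a *: v]addr0 dot_linear dot0r addr0. Qed.

Lemma dotDl p (u v w : 'cV[R]_p) : dot (v + w) u = dot v u + dot w u.
Proof. by rewrite dotC dotDr !(dotC u). Qed.

Lemma dotZl p (u v : 'cV[R]_p) a : dot (a *: v) u = a * dot v u.
Proof. by rewrite dotC dotZr dotC. Qed.

Lemma dot0l p (u : 'cV[R]_p) : dot 0 u = 0.
Proof. by rewrite dotC dot0r. Qed.

Lemma dotNr p (u v : 'cV[R]_p) : dot u (- v) = - dot u v.
Proof. by rewrite -scaleN1r dotZr mulN1r. Qed.

Lemma dotNl p (u v : 'cV[R]_p) : dot (- v) u = - dot v u.
Proof. by rewrite dotC dotNr dotC. Qed.

Lemma dot_ge0 p (v : 'cV[R]_p) : 0 <= dot v v.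
Proof. by apply: sumr_ge0 => i _; rewrite -expr2 sqr_ge0. Qed.

Lemma dot_eq0 p (v : 'cV[R]_p) : (dot v v == 0) = (v == 0).
Proof.
apply/eqP/eqP => [|->]; last exact: dot0r.
have ge0 (i : 'I_p) : true -> 0 <= v i 0 * v i 0 by rewrite -expr2 sqr_ge0.
move=> /psumr_eq0P vv; apply/colP => i; rewrite mxE.
by have /eqP := vv ge0 i isT; rewrite mulf_eq0 orbb => /eqP.
Qed.

Lemma dot_ext p (u v : 'cV[R]_p) : (forall w, dot u w = dot v w) -> u = v.
Proof.
move=> uv; apply/eqP; rewrite -subr_eq0 -dot_eq0 dotDl dotNl uv.
by rewrite subrr.
Qed.

Lemma enorm_ge0 p (v : 'cV[R]_p) : 0 <= enorm v.
Proof. exact: sqrtr_ge0. Qed.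

Lemma sqr_enorm p (v : 'cV[R]_p) : enorm v ^+ 2 = dot v v.
Proof. by rewrite sqr_sqrtr ?dot_ge0. Qed.

Lemma enorm_eq0 p (v : 'cV[R]_p) : (enorm v == 0) = (v == 0).
Proof. by rewrite -dot_eq0 -sqr_enorm sqrf_eq0. Qed.

Lemma enorm_gt0 p (v : 'cV[R]_p) : (0 < enorm v) = (v != 0).
Proof. by rewrite lt_def enorm_ge0 andbT enorm_eq0. Qed.

Lemma enormZ p (v : 'cV[R]_p) a : enorm (a *: v) = `|a| * enorm v.
Proof.
by rewrite /enorm dotZl dotZr mulrA -expr2 sqrtrM ?sqr_ge0// sqrtr_sqr.
Qed.

Lemma dot_col_mx p q (u u' : 'cV[R]_p) (v v' : 'cV[R]_q) :
  dot (col_mx u v) (col_mx u' v') = dot u u' + dot v v'.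
Proof.
rewrite /dot big_split_ord /=; congr (_ + _); apply: eq_bigr => i _.
  by rewrite !col_mxEu.
by rewrite !col_mxEd.
Qed.

Lemma eq_mulmx_cV p q (A C : 'M[R]_(q, p)) :
  (forall x : 'cV[R]_p, A *m x = C *m x) -> A = C.
Proof.
move=> AC; apply/matrixP => i j; have /colP/(_ i) := AC (delta_mx j 0).
by rewrite -!colE !mxE.
Qed.

End Dot.

(** * The bracket of an H-type group as a map on R^(2n) *)

(** What the flow uses of the H-type structure. Orthogonality of [J] for unit vectors becomes, by
    homogeneity, an identity valid for every eta. *)
Record Htype_bracket {R : realType} {p q : nat}
    (B : 'cV[R]_p -> 'cV[R]_p -> 'cV[R]_q) : Prop := {
  Htype_linearr : forall u, linear (B u);
  Htype_linearl : forall v, linear (B ^~ v);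
  Htype_alt : forall u, B u u = 0;
  Htype_dotJ : forall eta x y,
    dot (Jmx B eta *m x) (Jmx B eta *m y) = dot eta eta * dot x y }.

Lemma JmxZ (R : realType) p q (B : 'cV[R]_p -> 'cV[R]_p -> 'cV[R]_q) a eta :
  Jmx B (a *: eta) = a *: Jmx B eta.
Proof. by apply/matrixP => i j; rewrite !mxE dotZl. Qed.

Section HtypeGroup.
Context {R : realType} {n m : nat}.
Variable b : 'cV[R]_(2 * n + m) -> 'cV[R]_(2 * n + m) -> 'cV[R]_(2 * n + m).
Hypothesis hG : Htype_group b.

Lemma orthc_center_col_mx (x : 'cV[R]_(2 * n)) :
  orthc (Lie_center b) (col_mx x 0).
Proof.
case: hG => _ _ _ -> u /= u0.
by rewrite -[u]vsubmxK u0 dot_col_mx dot0l dot0r addr0.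
Qed.

(** A single bracket of vectors orthogonal to the center is a one-term element of the span, hence
    central: the projection in [hbracket] discards only a zero component. *)
Lemma bracket_col_mx (x y : 'cV[R]_(2 * n)) :
  b (col_mx x 0) (col_mx y 0) = col_mx 0 (hbracket b x y).
Proof.
case: hG => _ _ [_ span _] center.
have : Lie_center b (b (col_mx x 0) (col_mx y 0)).
  rewrite -span; exists [:: (1, (col_mx x 0, col_mx y 0))]; split.
    by move=> c; rewrite inE => /eqP ->; split; exact: orthc_center_col_mx.
  by rewrite big_seq1 scale1r.
by rewrite center /= => u0; rewrite -[LHS]vsubmxK u0.
Qed.

Lemma hbracket_linearr x : linear (hbracket b x).
Proof.
case: hG => _ _ [[br _ _ _] _ _] _ a u v; rewrite /hbracket -linearP -br.
by rewrite scale_col_mx add_col_mx scaler0 addr0.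
Qed.

Lemma hbracket_linearl y : linear (hbracket b ^~ y).
Proof.
case: hG => _ _ [[_ bl _ _] _ _] _ a u v; rewrite /hbracket -linearP.
by have /= <- := bl (col_mx y 0) a; rewrite scale_col_mx add_col_mx scaler0 addr0.
Qed.

(** Identifies the two versions of J. The upper blocks agree when tested against every y; the lower
    block is central while the image of J is orthogonal to the center, so its squared norm is 0. *)
Lemma Jmx_col_mx (eta : 'cV[R]_m) (x : 'cV[R]_(2 * n)) :
  Jmx b (col_mx 0 eta) *m col_mx x 0 = col_mx (Jmx (hbracket b) eta *m x) 0.
Proof.
case: (hG) => _ _ [bL _ _] center; case: (bL) => br bl _ _.
set w := LHS; rewrite -[w]vsubmxK; congr col_mx.
  apply: dot_ext => y.
  rewrite (JmxP _ _ _ hbracket_linearr hbracket_linearl).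
  have : dot w (col_mx y 0) = dot (usubmx w) y.
    by rewrite -{1}[w]vsubmxK dot_col_mx dot0r addr0.
  move=> <-; rewrite JmxP // bracket_col_mx dot_col_mx dot0l add0r.
  by [].
have : Lie_center b (col_mx 0 (dsubmx w)) by rewrite center /= col_mxKu.
move=> /(Jmx_orthc (col_mx 0 eta) (col_mx x 0) bL); rewrite -/w -{2}[w]vsubmxK.
by rewrite dot_col_mx dot0l add0r => /eqP; rewrite dot_eq0 => /eqP.
Qed.

(** For eta nonzero, apply orthogonality to the unit vector eta/|eta| and scale back, J being linear
    in eta. *)
Lemma Htype_bracket_hbracket : Htype_bracket (hbracket b).
Proof.
split=> [||u|eta x y].
- exact: hbracket_linearr.
- exact: hbracket_linearl.
- by case: hG => _ _ [[_ _ alt _] _ _] _; rewrite /hbracket alt linear0.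
have [->|eta0] := eqVneq eta 0.
  by rewrite -{1 2}(scale0r (0 : 'cV[R]_m)) !JmxZ !scale0r !mul0mx !dot0l mul0r.
have [_ _ [_ _ orth] center] := hG.
have e0 : enorm eta != 0 by rewrite enorm_eq0.
pose u := (enorm eta)^-1 *: eta.
have etaE : eta = enorm eta *: u by rewrite scalerA divff// scale1r.
have nu : enorm u = 1 by rewrite enormZ ger0_norm ?invr_ge0 ?enorm_ge0// mulVf.
have uC : Lie_center b (col_mx 0 u) by rewrite center /= col_mxKu.
have u1 : enorm (col_mx 0 u : 'cV_(2 * n + m)) = 1.
  by rewrite /enorm dot_col_mx dot0l add0r.
have := orth _ uC u1 _ _ (orthc_center_col_mx x) (orthc_center_col_mx y).
rewrite !Jmx_col_mx !dot_col_mx !dot0l !addr0 => uxy.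
by rewrite -sqr_enorm {1 2}etaE JmxZ -!scalemxAl dotZl dotZr uxy mulrA -expr2.
Qed.

End HtypeGroup.

(** * Algebra of the maps J *)

Section HtypeBracket.
Context {R : realType} {p q : nat} (B : 'cV[R]_p -> 'cV[R]_p -> 'cV[R]_q).
Hypothesis hB : Htype_bracket B.
Local Notation J := (Jmx B).

Lemma bracketDr u v w : B u (v + w) = B u v + B u w.
Proof. by have := Htype_linearr hB u 1 v w; rewrite !scale1r. Qed.

Lemma bracketDl u v w : B (v + w) u = B v u + B w u.
Proof. by have := Htype_linearl hB u 1 v w; rewrite /= !scale1r. Qed.

Lemma bracket0r u : B u 0 = 0.
Proof. by apply: (addrI (B u 0)); rewrite -bracketDr !addr0. Qed.

Lemma bracket0l u : B 0 u = 0.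
Proof. by apply: (addrI (B 0 u)); rewrite -bracketDl !addr0. Qed.

Lemma bracketZr u a v : B u (a *: v) = a *: B u v.
Proof. by rewrite -[a *: v]addr0 (Htype_linearr hB) bracket0r addr0. Qed.

Lemma bracketZl u a v : B (a *: v) u = a *: B v u.
Proof. by rewrite -[a *: v]addr0 (Htype_linearl hB u a v 0) bracket0l addr0. Qed.

Lemma bracketC u v : B u v = - B v u.
Proof.
apply/eqP; rewrite -addr_eq0 -[X in X == 0]/(B u v + B v u).
have := Htype_alt hB (u + v).
by rewrite bracketDr !bracketDl !(Htype_alt hB) add0r addr0 addrC => ->.
Qed.

Lemma dot_Jmx eta x y : dot (J eta *m x) y = dot eta (B x y).
Proof. exact: JmxP (Htype_linearr hB) (Htype_linearl hB). Qed.

Lemma Jmx_skew eta x y : dot x (J eta *m y) = - dot (J eta *m x) y.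
Proof. by rewrite dotC !dot_Jmx bracketC dotNr. Qed.

(** By skew-symmetry <J J x, y> = - <J x, J y> = - |eta|^2 <x, y>. *)
Lemma Jmx_sqr eta : J eta *m J eta = - (enorm eta ^+ 2)%:M.
Proof.
apply: eq_mulmx_cV => x; apply: dot_ext => y.
rewrite -mulmxA mulNmx mul_scalar_mx dotNl dotZl sqr_enorm -(Htype_dotJ hB).
by rewrite Jmx_skew opprK.
Qed.

Lemma JmxD eta zeta : J (eta + zeta) = J eta + J zeta.
Proof. by apply/matrixP => i j; rewrite !mxE dotDl. Qed.

(** Polarization in eta of |J_eta x|^2 = |eta|^2 |x|^2. *)
Lemma dot_Jmx_Jmx eta zeta x :
  dot (J eta *m x) (J zeta *m x) = dot eta zeta * dot x x.
Proof.
have := Htype_dotJ hB (eta + zeta) x x.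
rewrite JmxD mulmxDl !dotDl !dotDr !(Htype_dotJ hB).
rewrite [dot (J zeta *m x) (J eta *m x)]dotC [dot zeta eta]dotC => H; lra.
Qed.

(** Pairing with zeta gives <J_zeta x, J_eta x> = <eta, zeta> |x|^2. *)
Lemma bracket_Jmx eta x : B x (J eta *m x) = dot x x *: eta.
Proof.
apply: dot_ext => zeta; rewrite dotC -dot_Jmx dot_Jmx_Jmx dotZl mulrC.
by rewrite dotC.
Qed.

(** On the span of x and J x the bracket is the determinant of the coefficients times [x, J x].
    Position and velocity of a geodesic both lie in the span of xi0 and J xi0. *)
Lemma bracket_comb_Jmx (eta : 'cV[R]_q) (x : 'cV[R]_p) (a c a' c' : R) :
  B (a *: x + c *: (J eta *m x)) (a' *: x + c' *: (J eta *m x)) =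
  ((a * c' - c * a') * dot x x) *: eta.
Proof.
rewrite bracketDr !bracketDl !bracketZr !bracketZl !(Htype_alt hB).
rewrite [B (J eta *m x) x]bracketC bracket_Jmx !scaler0 add0r addr0.
rewrite !scalerN !scalerA addrC -scalerBl -mulrBl.
by rewrite [c' * a]mulrC [a' * c]mulrC.
Qed.

Lemma dot_comb_Jmx (eta : 'cV[R]_q) (x : 'cV[R]_p) (a c : R) :
  dot (a *: x + c *: (J eta *m x)) (a *: x + c *: (J eta *m x)) =
  (a ^+ 2 + c ^+ 2 * enorm eta ^+ 2) * dot x x.
Proof.
have xJ : dot x (J eta *m x) = 0.
  by rewrite dotC dot_Jmx (Htype_alt hB) dot0r.
rewrite dotDl !dotDr !dotZl !dotZr (Htype_dotJ hB) [dot (_ *m _) _]dotC xJ.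
rewrite -(sqr_enorm eta); ring.
Qed.

End HtypeBracket.

(** * The exponential of a matrix whose square is a negative scalar *)

Section Expmx.
Context {R : realType} {p : nat}.

Lemma exprmx_even (A : 'M[R]_p) (w : R) (k : nat) : A *m A = - (w ^+ 2)%:M ->
  A ^+ k.*2 = ((-1) ^+ k * w ^+ k.*2)%:M.
Proof.
move=> AA; elim: k => [|k IH]; first by rewrite !expr0 mulr1.
rewrite doubleS !exprS IH -[LHS]/(A *m (A *m _)) mulmxA AA mulNmx -scalar_mxM.
by rewrite -raddfN /=; congr _%:M; ring.
Qed.

(** Even powers of A are scalar and sum to the cosine series; odd powers are scalar multiples of A
    and sum to the sine series, with a factor 1/w since A^(2j+1) = (-1)^j w^(2j) A. *)
Lemma expmxZ_sqr (A : 'M[R]_p) (w t : R) : w != 0 -> A *m A = - (w ^+ 2)%:M ->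
  expmx (t *: A) = (cos (w * t))%:M + (sin (w * t) / w) *: A.
Proof.
move=> w0 AA.
have coeffE k : (k`!%:R)^-1 *: (t *: A) ^+ k =
    cos_coeff (w * t) k *: 1%:M + sin_coeff (w * t) k *: (w^-1 *: A).
  have k0 : (k`!%:R : R) != 0 by rewrite pnatr_eq0 -lt0n fact_gt0.
  have tt : (t *: A) *m (t *: A) = - ((w * t) ^+ 2)%:M.
    rewrite -scalemxAl -scalemxAr AA scalerA scalerN scale_scalar_mx.
    by congr (- _%:M); ring.
  have [[j kE]|[j kE]] : (exists j, k = j.*2) \/ (exists j, k = j.*2.+1).
    by case E : (odd k); [right|left]; exists k./2; rewrite -[LHS]odd_double_half E.
  - rewrite kE sin_coeff_even scale0r addr0 (exprmx_even _ tt) /cos_coeff /=.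
    rewrite odd_double doubleK !scale_scalar_mx; congr _%:M.
    by rewrite mul1r mulr1 mulrC.
  - rewrite kE in k0 *; rewrite cos_coeff_odd scale0r add0r exprS.
    rewrite (exprmx_even _ tt) /sin_coeff /=.
    rewrite odd_double doubleK /= -[(t *: A) * _]/((t *: A) *m _) mul_mx_scalar !scalerA.
    congr (_ *: _); rewrite mul1r exprS; move: (_`!) k0 => f f0; field.
    by rewrite w0 f0.
rewrite /expmx; apply: cvg_lim; first exact: norm_hausdorff.
have -> : series (fun k => (k`!%:R)^-1 *: (t *: A) ^+ k) = fun n =>
    series (cos_coeff (w * t)) n *: 1%:M + series (sin_coeff (w * t)) n *: (w^-1 *: A).
  apply/funext => n; rewrite /series /= !scaler_suml -big_split /=.
  by apply: eq_bigr => k _.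
rewrite -[(cos _)%:M]scalemx1 -scalerA; apply: cvgD.
  by apply: cvgZr_tmp; rewrite unlock; exact: is_cvg_series_cos_coeff.
by apply: cvgZr_tmp; rewrite unlock; exact: is_cvg_series_sin_coeff.
Qed.

End Expmx.

(** * Facts on sine and cosine *)

Section Trigo.
Context {R : realType}.

(** For w > 1 the bound sin w <= 1 suffices. Otherwise sin w = w cos c with 0 < c < w <= 1, and
    cosine decreases strictly on [0, pi]. *)
Lemma sin_lt_id (w : R) : 0 < w -> sin w < w.
Proof.
move=> w0; have [w1|w1] := leP w 1; last exact: le_lt_trans (sin_le1 w) w1.
have [c|c] := @MVT R sin cos 0 w w0 (fun x _ => is_derive_sin x).
  by apply: continuous_subspaceT => ?; exact: continuous_sin.
rewrite in_itv /= sin0 !subr0 => /andP[c0 cw] ->.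
rewrite gtr_pMl// -(@cos0 R) ltr_cos// in_itv /= ?lexx ?pi_ge0//.
by rewrite ltW//= (le_trans (ltW cw))// (le_trans w1)// (le_trans _ (pi_ge2 R))// ler1n.
Qed.

Lemma sin_mulrz_pi (k : int) : sin (k%:~R * pi : R) = 0.
Proof.
have sin_nat (j : nat) : sin (j%:R * pi : R) = 0.
  by rewrite mulr_natl -[pi *+ j]add0r (alternatingn (@sinDpi R)) sin0 mulr0.
case: k => j; first exact: sin_nat.
by rewrite NegzE mulrNz mulNr sinN sin_nat oppr0.
Qed.

Lemma cos_2_mulrz_pi (k : int) : cos (2 * (k%:~R * pi) : R) = 1.
Proof.
by rewrite mulr_natl cos_mulr2n cos2sin2 sin_mulrz_pi expr0n subr0 mulr2n addrK.
Qed.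

(** Take k as the integer part of w / (2 pi); the remainder r lies in [0, 2 pi) and has cosine 1. *)
Lemma cos_eq1_nat (w : R) : 0 <= w -> cos w = 1 -> exists k : nat, w = 2 * pi * k%:R.
Proof.
move=> w0 cw1.
have pi2 : 0 < 2 * pi :> R by rewrite mulr_gt0// (pi_gt0 R).
have /truncn_itv := divr_ge0 w0 (ltW pi2).
set k := Num.truncn _; rewrite ler_pdivlMr// ltr_pdivrMr// => /andP[kw wk].
exists k; apply/eqP; rewrite -subr_eq0.
set r := w - _.
have wE : w = r + (pi *+ 2) *+ k by rewrite /r -mulr_natl -(mulr_natl pi); ring.
have r0 : 0 <= r by rewrite /r subr_ge0 mulrC.
have r2 : r < 2 * pi by move: wk; rewrite /r ltrBlDl -natr1; lra.
have : cos r = 1 by rewrite -cw1 wE (periodicn (@cosD2pi R)).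
have pi0 := @pi_ge0 R.
(* Cosine is injective on [0, pi] only; for r > pi the reflected angle 2 pi - r must be 0, against r
   < 2 pi. *)
have [rpi|rpi] := leP r pi => cr1.
  by apply/eqP/cos_inj; rewrite ?in_itv/= ?r0 ?lexx ?cos0.
have : pi *+ 2 - r = 0.
  apply: cos_inj; rewrite ?in_itv/= ?lexx ?pi0//.
    by rewrite -mulr_natl subr_ge0 ltW//=; lra.
  by rewrite cosB cos2pi sin2pi mul1r mul0r addr0 cos0.
by rewrite -mulr_natl; lra.
Qed.

End Trigo.

(** * Closed forms of the geodesics *)

Section NormalForm.
Context {R : realType} {p q : nat} (B : 'cV[R]_p -> 'cV[R]_p -> 'cV[R]_q).
Hypothesis hB : Htype_bracket B.
Variables (eta0 : 'cV[R]_q) (xi0 : 'cV[R]_p).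
Local Notation J := (Jmx B eta0).
Local Notation w := (enorm eta0).

(** The integral of exp(sJ) xi0 over s from 0 to t, expanded along xi0 and J xi0 so that identities
    reduce to scalar ones in each entry. *)
Definition geodesic_x (t : R) : 'cV[R]_p :=
  (sin (w * t) / w) *: xi0 + ((1 - cos (w * t)) / w ^+ 2) *: (J *m xi0).

(** This is exp(tJ) xi0. *)
Definition geodesic_v (t : R) : 'cV[R]_p :=
  cos (w * t) *: xi0 + (sin (w * t) / w) *: (J *m xi0).

Definition geodesic_z (t : R) : 'cV[R]_q :=
  (enorm xi0 ^+ 2 / (2 * w ^+ 3) * (w * t - sin (w * t))) *: eta0.

Lemma geodesic_x0 : geodesic_x 0 = 0.
Proof. by rewrite /geodesic_x mulr0 sin0 cos0 subrr !mul0r !scale0r addr0. Qed.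

Lemma geodesic_z0 : geodesic_z 0 = 0.
Proof. by rewrite /geodesic_z mulr0 sin0 subrr mulr0 scale0r. Qed.

Lemma mulJJ (x : 'cV[R]_p) : J *m (J *m x) = - (w ^+ 2 *: x).
Proof. by rewrite mulmxA (Jmx_sqr hB) mulNmx mul_scalar_mx. Qed.

(* The right-hand side of the z-equation in terms of v = xi + J x / 2. *)
Lemma bracket_velocity (x v : 'cV[R]_p) :
  (4^-1 * enorm x ^+ 2) *: eta0 + 2^-1 *: B x (v - 2^-1 *: (J *m x)) =
  2^-1 *: B x v.
Proof.
(* The [J x] part of the bracket contributes - |x|^2 eta0 / 4, which cancels the first term. *)
rewrite -scaleNr (bracketDr hB) (bracketZr hB) (bracket_Jmx hB) sqr_enorm.
rewrite scalerDr !scalerA addrCA -scalerDl -[RHS]addr0; congr (_ + _).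
by rewrite -[RHS](scale0r eta0); congr (_ *: _); field.
Qed.

Hypothesis w0 : w != 0.

Lemma derive01_geodesic_x (t : R) : derive01 geodesic_x t (geodesic_v t).
Proof.
have := derive01D (derive01Zl (v := w^-1 *: xi0) (@derive01_sin R w t))
  (derive01D (@derive01_cst R _ ((w ^+ 2)^-1 *: (J *m xi0)) t)
     (derive01Zl (v := - (w ^+ 2)^-1 *: (J *m xi0)) (@derive01_cos R w t))).
rewrite /geodesic_x /geodesic_v; set y := J *m xi0.
by apply: derive01_eq => [s|]; apply/matrixP => i j; rewrite !mxE; field.
Qed.

Lemma mul_J_geodesic_v (t : R) :
  J *m geodesic_v t = cos (w * t) *: (J *m xi0) - (w * sin (w * t)) *: xi0.
Proof.
rewrite mulmxDr -!scalemxAr mulJJ.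
by apply/matrixP => i j; rewrite !mxE; field.
Qed.

Lemma derive01_geodesic_v (t : R) : derive01 geodesic_v t (J *m geodesic_v t).
Proof.
rewrite mul_J_geodesic_v.
have := derive01D (derive01Zl (v := xi0) (@derive01_cos R w t))
  (derive01Zl (v := w^-1 *: (J *m xi0)) (@derive01_sin R w t)).
rewrite /geodesic_v; set y := J *m xi0.
by apply: derive01_eq => [s|]; apply/matrixP => i j; rewrite !mxE; field.
Qed.

(** The determinant of position and velocity is (sin^2 - (1 - cos) cos) / w^2 = (1 - cos) / w^2. *)
Lemma derive01_geodesic_z (t : R) :
  derive01 geodesic_z t (2^-1 *: B (geodesic_x t) (geodesic_v t)).
Proof.
have := derive01D (derive01Zl (v := (enorm xi0 ^+ 2 / (2 * w ^+ 2)) *: eta0)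
    (@derive01_id R t))
  (derive01Zl (v := - (enorm xi0 ^+ 2 / (2 * w ^+ 3)) *: eta0) (@derive01_sin R w t)).
rewrite (bracket_comb_Jmx hB) -sqr_enorm.
have := cos2Dsin2 (w * t); move: (cos _) (sin _) => c s cs.
apply: derive01_eq => [u|]; apply/matrixP => i j; rewrite !mxE; first by field.
have -> : s / w * (s / w) = (1 - c ^+ 2) / w ^+ 2 by rewrite -cs; field.
by field.
Qed.

Lemma expmx_Jmx (t : R) :
  expmx (t *: J) = (cos (w * t))%:M + (sin (w * t) / w) *: J.
Proof. exact: expmxZ_sqr w0 (Jmx_sqr hB eta0). Qed.

(** Since J^2 = - w^2, J (I - exp(tJ)) equals (1 - cos) J + w sin. *)
Lemma geodesic_x_expmx (t : R) :
  (w ^+ 2)^-1 *: (J *m (1%:M - expmx (t *: J)) *m xi0) = geodesic_x t.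
Proof.
rewrite expmx_Jmx -mulmxA mulmxBl mulmxDl mul1mx mul_scalar_mx -scalemxAl.
rewrite mulmxBr mulmxDr -!scalemxAr mulJJ /geodesic_x.
by move: (J *m xi0) => y; apply/matrixP => i j; rewrite !mxE; field.
Qed.

Lemma dot_geodesic_x1 :
  enorm (geodesic_x 1) ^+ 2 = 2 * (1 - cos w) / w ^+ 2 * enorm xi0 ^+ 2.
Proof.
rewrite (sqr_enorm (geodesic_x 1)) (sqr_enorm xi0) (dot_comb_Jmx hB) mulr1; congr (_ * _).
have := cos2Dsin2 w; move: (cos w) (sin w) => c s cs.
have -> : (s / w) ^+ 2 = (1 - c ^+ 2) / w ^+ 2 by rewrite -cs; field.
by field.
Qed.

(** The matrix is (c - 1) J - s w, which behaves like a complex number of squared modulus ((c - 1)^2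
    + s^2) w^2 = 2 (1 - c) w^2, nonzero when c differs from 1. *)
Lemma unitmx_Jmx_expmx : cos w != 1 -> J *m (expmx J - 1%:M) \in unitmx.
Proof.
move=> c1; pose c := cos w; pose s := sin w.
have ME : J *m (expmx J - 1%:M) = (c - 1) *: J - (s * w)%:M.
  rewrite -{2}[J]scale1r expmx_Jmx !mulr1 -/c -/s mulmxBr mulmxDr mul_mx_scalar.
  rewrite -scalemxAr (Jmx_sqr hB) mulmx1.
  by apply/matrixP => i j; rewrite !mxE; field.
(* The conjugate divided by the squared modulus. *)
pose N := (- (2 * w ^+ 2 * (c - 1))^-1) *: (- (c - 1) *: J - (s * w)%:M).
have d0 : c - 1 != 0 by rewrite subr_eq0.
have cs : s ^+ 2 = 1 - c ^+ 2 by rewrite /s sin2cos2.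
suff /mulmx1_unit[] : J *m (expmx J - 1%:M) *m N = 1%:M by [].
rewrite ME /N -scalemxAr mulmxBr !mulmxBl -!scalemxAl -!scalemxAr (Jmx_sqr hB).
rewrite !mul_scalar_mx !mul_mx_scalar.
apply/matrixP => i j; rewrite !mxE.
rewrite [X in _ * X](_ : _ = ((c - 1) ^+ 2 + s ^+ 2) * w ^+ 2 * (i == j)%:R).
  by rewrite cs; field; rewrite d0 w0.
ring.
Qed.

End NormalForm.

(** * Hamilton's equations and the closed forms *)

Section Hamilton.
Context {R : realType} {n m : nat}.
Variable b : 'cV[R]_(2 * n + m) -> 'cV[R]_(2 * n + m) -> 'cV[R]_(2 * n + m).
Hypothesis hG : Htype_group b.
Let hB := Htype_bracket_hbracket hG.

Section Flow.
Variables (x : R -> 'cV[R]_(2 * n)) (z : R -> 'cV[R]_m)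
  (xi : R -> 'cV[R]_(2 * n)) (eta : R -> 'cV[R]_m).
Hypotheses (ham : Hamilton_solution b x z xi eta) (x0 : x 0 = 0) (z0 : z 0 = 0).
Local Notation J := (Jmx (hbracket b) (eta 0)).
Local Notation w := (enorm (eta 0)).

Lemma Hamilton_eta_cst t : 0 <= t <= 1 -> eta t = eta 0.
Proof.
by move=> t01; apply: (derive01_mx_0_cst _ t01) => s s01; case: (ham s01).
Qed.

Let v t := xi t + 2^-1 *: (J *m x t).

Lemma Hamilton_derive_x t : 0 <= t <= 1 -> derive01 x t (v t).
Proof. by move=> t01; case: (ham t01); rewrite (Hamilton_eta_cst t01). Qed.

(** As - |eta|^2 x / 4 = J^2 x / 4, the derivative of xi is J v / 2; that of J x / 2 is J v / 2 as
    well. *)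
Lemma Hamilton_derive_v t : 0 <= t <= 1 -> derive01 v t (J *m v t).
Proof.
move=> t01; case: (ham t01) => _ _ + _; rewrite (Hamilton_eta_cst t01) => dxi.
have := derive01D dxi (derive01Zr (c := 2^-1)
  (derive01_mulmx (A := J) (Hamilton_derive_x t01))).
apply: derive01_eq => //.
rewrite /v !mulmxDr -!scalemxAr (mulJJ hB).
by move: (J *m xi t) => y; apply/matrixP => i j; rewrite !mxE; field.
Qed.

Lemma Hamilton_derive_z t : 0 <= t <= 1 ->
  derive01 z t (2^-1 *: hbracket b (x t) (v t)).
Proof.
move=> t01; case: (ham t01) => _ + _ _; rewrite (Hamilton_eta_cst t01).
by rewrite -(bracket_velocity hB (eta 0) (x t) (v t)) /v addrK.
Qed.

Lemma Hamilton_velocity0 : v 0 = xi 0.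
Proof. by rewrite /v x0 mulmx0 scaler0 addr0. Qed.

(** With J = 0 the velocity is constant, so x stays on the line of xi(0) and the bracket driving z
    vanishes. *)
Lemma Hamilton_line : eta 0 = 0 ->
  forall t, 0 <= t <= 1 -> x t = t *: xi 0 /\ z t = 0.
Proof.
move=> e0.
have J0 : J = 0 by rewrite e0 -(scale0r (0 : 'cV[R]_m)) JmxZ scale0r.
have v_cst t : 0 <= t <= 1 -> v t = xi 0.
  move=> t01; rewrite -Hamilton_velocity0.
  apply: (derive01_mx_0_cst _ t01) => s /Hamilton_derive_v.
  by rewrite J0 mul0mx.
have xE t : 0 <= t <= 1 -> x t = t *: xi 0.
  move=> t01; apply: (@eq_derive01 _ _ x (fun s => s *: xi 0) (fun=> xi 0) t) => //.
  - by move=> s s01; rewrite -(v_cst s)//; exact: Hamilton_derive_x.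
  - by move=> s _; rewrite -[X in derive01 _ _ X]scale1r; exact/derive01Zl/derive01_id.
  - by rewrite x0 scale0r.
move=> t t01; split; first exact: xE.
rewrite -z0; apply: (derive01_mx_0_cst _ t01) => s s01.
have := Hamilton_derive_z s01; rewrite xE// v_cst// (bracketZl hB) (Htype_alt hB).
by rewrite !scaler0.
Qed.

(* exp(-tJ) v(t) is a first integral. *)
Lemma Hamilton_geodesic : eta 0 != 0 -> forall t, 0 <= t <= 1 ->
  x t = geodesic_x (hbracket b) (eta 0) (xi 0) t /\ z t = geodesic_z (eta 0) (xi 0) t.
Proof.
rewrite -enorm_eq0 => w0.
pose u t := cos (w * t) *: v t + (- w^-1) *: (sin (w * t) *: (J *m v t)).
have u_cst t : 0 <= t <= 1 -> u t = xi 0.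
  move=> t01; have -> : xi 0 = u 0.
    by rewrite /u mulr0 cos0 sin0 scale0r scaler0 addr0 scale1r Hamilton_velocity0.
  apply: (derive01_mx_0_cst _ t01) => s s01.
  have dv := Hamilton_derive_v s01.
  have := derive01D (derive01Z (@derive01_cos R w s) dv)
    (derive01Zr (c := - w^-1)
      (derive01Z (@derive01_sin R w s) (derive01_mulmx (A := J) dv))).
  apply: derive01_eq => //; rewrite (mulJJ hB); move: (J *m v s) => y.
  by apply/matrixP => i j; rewrite !mxE; field.
have vE t : 0 <= t <= 1 -> v t = geodesic_v (hbracket b) (eta 0) (xi 0) t.
  move=> /u_cst <-; rewrite /geodesic_v /u; move: (v t) => y.
  rewrite mulmxDr -!scalemxAr (mulJJ hB); move: (J *m y) => Jy.
  (* Inverting u = exp(-tJ) v as v = exp(tJ) u; cos^2 + sin^2 = 1 enters as the coefficient of v. *)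
  rewrite -[LHS]scale1r -(cos2Dsin2 (w * t)); move: (cos _) (sin _) => c s.
  by apply/matrixP => i j; rewrite !mxE; field.
have xE t : 0 <= t <= 1 -> x t = geodesic_x (hbracket b) (eta 0) (xi 0) t.
  move=> t01.
  apply: (@eq_derive01 _ _ x _ (geodesic_v (hbracket b) (eta 0) (xi 0)) t) => //.
  - by move=> s s01; rewrite -vE//; exact: Hamilton_derive_x.
  - by move=> s _; exact: derive01_geodesic_x.
  - by rewrite x0 geodesic_x0.
move=> t t01; split; first exact: xE.
apply: (@eq_derive01 _ _ z _ (fun s => 2^-1 *: hbracket b
  (geodesic_x (hbracket b) (eta 0) (xi 0) s)
  (geodesic_v (hbracket b) (eta 0) (xi 0) s)) t) => //.
- by move=> s s01; rewrite -vE// -xE//; exact: Hamilton_derive_z.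
- by move=> s _; exact: derive01_geodesic_z.
- by rewrite z0 geodesic_z0.
Qed.

End Flow.

(** The covector is recovered from the velocity as xi = v - J x / 2. The given x and z are known on
    [0, 1] only, which suffices for the restricted derivative. *)
Lemma geodesic_Hamilton (x : R -> 'cV[R]_(2 * n)) (z : R -> 'cV[R]_m)
    (eta0 : 'cV[R]_m) (xi0 : 'cV[R]_(2 * n)) : eta0 != 0 ->
  (forall t, 0 <= t <= 1 ->
    x t = geodesic_x (hbracket b) eta0 xi0 t /\ z t = geodesic_z eta0 xi0 t) ->
  Hamilton_solution b x z (fun t => geodesic_v (hbracket b) eta0 xi0 t
    - 2^-1 *: (Jmx (hbracket b) eta0 *m geodesic_x (hbracket b) eta0 xi0 t))
    (fun=> eta0).
Proof.
rewrite -enorm_eq0 => w0 xz t t01 /=; have [-> _] := xz t t01.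
have dx := @derive01_geodesic_x _ _ _ (hbracket b) eta0 xi0 w0 t.
have dv := @derive01_geodesic_v _ _ _ _ hB eta0 xi0 w0 t.
split.
- rewrite subrK; apply: derive01_ext t01 _ dx => s s01.
  by have [] := xz s s01.
- rewrite (bracket_velocity hB).
  apply: derive01_ext t01 _ (@derive01_geodesic_z _ _ _ _ hB eta0 xi0 w0 t) => s s01.
  by have [] := xz s s01.
- set J := Jmx _ _ in dx dv *.
  have := derive01D dv (derive01Zr (c := - 2^-1) (derive01_mulmx (A := J) dx)).
  apply: derive01_eq => [s|]; first by rewrite scaleNr.
  rewrite mulmxBr -scalemxAr (mulJJ hB).
  by move: (J *m _) => y; apply/matrixP => i j; rewrite !mxE; field.
- exact: derive01_cst.
Qed.

Lemma line_Hamilton (x : R -> 'cV[R]_(2 * n)) (z : R -> 'cV[R]_m)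
    (xi0 : 'cV[R]_(2 * n)) :
  (forall t, 0 <= t <= 1 -> x t = t *: xi0 /\ z t = 0) ->
  Hamilton_solution b x z (fun=> xi0) (fun=> 0).
Proof.
move=> xz t t01 /=; have [-> _] := xz t t01.
have -> : Jmx (hbracket b) (0 : 'cV[R]_m) = 0.
  by rewrite -(scale0r (0 : 'cV[R]_m)) JmxZ scale0r.
rewrite !mul0mx !scaler0 !addr0 add0r (bracketZl hB) (Htype_alt hB) !scaler0.
have -> : enorm (0 : 'cV[R]_m) = 0 by apply/eqP; rewrite enorm_eq0.
rewrite expr0n mulr0 oppr0 scale0r; split; try exact: derive01_cst.
- apply: (@derive01_ext _ _ (fun s => s *: xi0)) => //.
    by move=> s s01; have [->] := xz s s01.
  by rewrite -[X in derive01 _ _ X]scale1r; exact/derive01Zl/derive01_id.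
- apply: (@derive01_ext _ _ (fun s => 0)) (derive01_cst _ _) => //.
  by move=> s s01; have [_ ->] := xz s s01.
Qed.

End Hamilton.

(** * Endpoints and the function nu *)

Section Endpoint.
Context {R : realType}.

Lemma nu_halfE (w : R) : w != 0 -> nu (w / 2) = (w - sin w) / (1 - cos w).
Proof.
move=> w0; rewrite /nu mulf_eq0 (negbTE w0) invr_eq0 pnatr_eq0 /=.
by rewrite (mulrC 2) divfK// pnatr_eq0.
Qed.

(** Division by 0 gives 0, so a positive value excludes cos (2 theta) = 1. The numerator is then
    positive, whereas sin u < u at u = - 2 theta makes it negative for theta < 0. *)
Lemma nu_gt0 (theta : R) : 0 < nu theta -> 0 < theta /\ cos (2 * theta) != 1.
Proof.
rewrite /nu; case: eqVneq => [->|t0]; first by rewrite ltxx.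
have [->|c1] := eqVneq (cos (2 * theta)) 1.
  by rewrite subrr invr0 mulr0 ltxx.
rewrite pmulr_lgt0; last first.
  by rewrite invr_gt0 subr_gt0 lt_def eq_sym c1 cos_le1.
rewrite subr_gt0 => st; split => //; rewrite lt_def t0 /= leNgt.
apply/negP => tn; have := @sin_lt_id R (- (2 * theta)).
rewrite sinN ltrN2 => /(_ _); rewrite (lt_gtF st) => H.
by suff: false by []; apply: H; lra.
Qed.

Context {p q : nat} (B : 'cV[R]_p -> 'cV[R]_p -> 'cV[R]_q).
Hypothesis hB : Htype_bracket B.
Variables (eta0 : 'cV[R]_q) (xi0 : 'cV[R]_p).
Hypothesis eta0_neq0 : eta0 != 0.
Local Notation J := (Jmx B eta0).
Local Notation w := (enorm eta0).
Local Notation x1 := (geodesic_x B eta0 xi0 1).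
Local Notation z1 := (geodesic_z eta0 xi0 1).

Let w_gt0 : 0 < w. Proof. by rewrite enorm_gt0. Qed.
Let w_neq0 : w != 0. Proof. by rewrite enorm_eq0. Qed.

Lemma enorm_geodesic_z1 :
  enorm z1 = enorm xi0 ^+ 2 / (2 * w ^+ 2) * (w - sin w).
Proof.
rewrite enormZ mulr1 ger0_norm; first by field.
apply: mulr_ge0; last by rewrite subr_ge0 ltW// sin_lt_id.
by rewrite divr_ge0 ?sqr_ge0// mulr_ge0// exprn_ge0// ltW.
Qed.

(** In the formula for |z(1)| both 1 / (2 w^2) and w - sin w are positive. *)
Lemma geodesic_z1_neq0 : (z1 != 0) = (xi0 != 0).
Proof.
rewrite -!enorm_gt0 enorm_geodesic_z1 pmulr_lgt0 ?subr_gt0 ?sin_lt_id//.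
have w2 : 0 < (2 * w ^+ 2)^-1 by rewrite invr_gt0 mulr_gt0// exprn_gt0.
by rewrite (pmulr_lgt0 _ w2) enorm_gt0 exprn_even_gt0//= enorm_eq0.
Qed.

(** z(1) is a positive multiple of eta0, so the endpoint fixes the direction of eta0 and leaves only
    its norm free. *)
Lemma geodesic_eta0 : xi0 != 0 -> eta0 = (w / enorm z1) *: z1.
Proof.
move=> xi0_neq0; rewrite enorm_geodesic_z1 /geodesic_z mulr1 scalerA.
have x0 : enorm xi0 != 0 by rewrite enorm_eq0.
have s0 : w - sin w != 0 by rewrite subr_eq0 gt_eqF// sin_lt_id.
by rewrite -[LHS]scale1r; congr (_ *: _); field; rewrite x0 s0 w_neq0.
Qed.

Lemma geodesic_x1_neq0 : (x1 != 0) = (cos w != 1) && (xi0 != 0).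
Proof.
rewrite -!enorm_eq0 -sqrf_eq0 (dot_geodesic_x1 hB)//.
rewrite !mulf_eq0 invr_eq0 !sqrf_eq0 (negbTE w_neq0) pnatr_eq0 orbF /= orbb.
by rewrite negb_or subr_eq0 eq_sym.
Qed.

(** The formula for x(1) as a linear equation in xi0, ready to be solved by inverting the matrix. *)
Lemma mul_Jmx_expmx_xi0 :
  J *m (expmx J - 1%:M) *m xi0 = - (w ^+ 2) *: x1.
Proof.
rewrite -(geodesic_x_expmx hB)// scale1r scalerA mulNr divff ?sqrf_eq0// scaleN1r.
by rewrite -mulNmx -mulmxN opprB.
Qed.

(** The common factor |xi0|^2 / w^2 cancels in the quotient. *)
Lemma nu_geodesic : x1 != 0 ->
  nu (w / 2) = 4 * enorm z1 / enorm x1 ^+ 2.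
Proof.
rewrite geodesic_x1_neq0 => /andP[c1 xi0_neq0].
rewrite nu_halfE// enorm_geodesic_z1 (dot_geodesic_x1 hB)//.
have x0 : enorm xi0 != 0 by rewrite enorm_eq0.
have c0 : 1 - cos w != 0 by rewrite subr_eq0 eq_sym.
by field; rewrite x0 c0 w_neq0.
Qed.

End Endpoint.

Theorem mainTheorem7 (R : realType) (n m : nat)
    (b : 'cV[R]_(2 * n + m) -> 'cV[R]_(2 * n + m) -> 'cV[R]_(2 * n + m))
    (hG : Htype_group b)
    (x : R -> 'cV[R]_(2 * n)) (z : R -> 'cV[R]_m)
    (x1 : 'cV[R]_(2 * n)) (z1 : 'cV[R]_m) :
  let J := Jmx (hbracket b) in
  (exists (xi : R -> 'cV[R]_(2 * n)) (eta : R -> 'cV[R]_m),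
      [/\ Hamilton_solution b x z xi eta,
          x 0 = 0, z 0 = 0, x 1 = x1 & z 1 = z1])
  <->
  (z1 = 0 -> forall t : R, 0 <= t <= 1 -> x t = t *: x1 /\ z t = 0) /\
  (z1 <> 0 ->
    exists (eta0 : 'cV[R]_m) (xi0 : 'cV[R]_(2 * n)),
      [/\ forall t : R, 0 <= t <= 1 ->
            x t = (enorm eta0 ^+ 2)^-1 *:
                    (J eta0 *m (1%:M - expmx (t *: J eta0)) *m xi0) /\
            z t = (enorm xi0 ^+ 2 / (2 * enorm eta0 ^+ 3)
                     * (enorm eta0 * t - sin (enorm eta0 * t))) *: eta0,
          x1 <> 0 ->
            exists theta : R,
              [/\ nu_defined theta,
                  nu theta = 4 * enorm z1 / enorm x1 ^+ 2,
                  eta0 = (2 * theta / enorm z1) *: z1,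
                  J eta0 *m (expmx (J eta0) - 1%:M) \in unitmx &
                  xi0 = - (enorm eta0 ^+ 2) *:
                    (invmx (J eta0 *m (expmx (J eta0) - 1%:M)) *m x1)] &
          x1 = 0 ->
            exists k : nat,
              [/\ (1 <= k)%N,
                  eta0 = (2 * pi * k%:R / enorm z1) *: z1 &
                  enorm xi0 = Num.sqrt (4 * k%:R * pi * enorm z1)]]).
Proof.
move=> J; have hB := Htype_bracket_hbracket hG.
have b01 : 0 <= (1 : R) <= 1 by rewrite ler01 lexx.
have a01 : 0 <= (0 : R) <= 1 by rewrite ler01 lexx.
split=> [[xi [eta [ham x0 z0 x1E z1E]]]|[line curve]].
  (* If eta = 0 the path is a line with z(1) = 0, so only the first item has content. *)
  have [e0|e0] := eqVneq (eta 0) 0.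
    have xz := Hamilton_line hG ham x0 z0 e0.
    split; last by rewrite -z1E; case: (xz 1 b01).
    move=> _ t t01; have [-> ->] := xz t t01; split => //.
    by rewrite -x1E; case: (xz 1 b01) => -> _; rewrite scale1r.
  have xz := Hamilton_geodesic hG ham x0 z0 e0.
  have [xE zE] := xz 1 b01; rewrite x1E in xE; rewrite z1E in zE.
  split.
    (* With eta nonzero, z(1) = 0 forces xi(0) = 0: the path rests at the origin, which is the line
       with x(1) = 0. *)
    move=> z10; have /eqP xi00 : xi 0 == 0.
      by rewrite -[_ == _]negbK -(geodesic_z1_neq0 (xi 0) e0) -zE z10 eqxx.
    move=> t t01; have [-> ->] := xz t t01; rewrite xE /geodesic_x /geodesic_z xi00.
    have -> : enorm (0 : 'cV[R]_(2 * n)) = 0 by apply/eqP; rewrite enorm_eq0.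
    by rewrite mulmx0 !scaler0 addr0 scaler0 expr0n !mul0r scale0r.
  move=> /eqP z1_neq0; exists (eta 0), (xi 0).
  have w0 : enorm (eta 0) != 0 by rewrite enorm_eq0.
  have xi0 : xi 0 != 0 by rewrite -(geodesic_z1_neq0 _ e0) -zE.
  have etaE := geodesic_eta0 e0 xi0; rewrite -zE in etaE.
  split=> [t t01|/eqP x1_neq0|x10].
  - by rewrite (geodesic_x_expmx hB)//; exact: xz.
  - have := x1_neq0; rewrite xE (geodesic_x1_neq0 hB)// => /andP[c1 _].
    have U := unitmx_Jmx_expmx hB w0 c1.
    exists (enorm (eta 0) / 2); split => //.
    (* |eta| / 2 = k pi would give cos |eta| = 1, hence x(1) = 0. *)
    + move=> k _; apply: contra c1 => /eqP wk; apply/eqP.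
      by rewrite -[RHS](cos_2_mulrz_pi k) -wk mulrC divfK// pnatr_eq0.
    + by rewrite (nu_geodesic hB e0 (xi0 := xi 0)) -?xE -?zE.
    + by rewrite (mulrC 2) divfK// pnatr_eq0.
    + by rewrite scalemxAr -(mul_Jmx_expmx_xi0 hB)// mulKmx.
  - have : ~~ (x1 != 0) by rewrite x10 eqxx.
    rewrite xE (geodesic_x1_neq0 hB)// xi0 andbT negbK => /eqP c1.
    have [k wk] := cos_eq1_nat (enorm_ge0 _) c1; exists k; split.
    + by rewrite lt0n; apply: contraNneq w0 => k0; rewrite wk k0 mulr0.
    + by rewrite -wk.
    (* As sin |eta| = 0, |z(1)| = |xi(0)|^2 / (2 |eta|), and 4 k pi = 2 |eta|. *)
    + have s0 : sin (enorm (eta 0)) = 0 by apply: cos1sin0; rewrite c1 normr1.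
      rewrite zE enorm_geodesic_z1// s0 subr0.
      rewrite (_ : 4 * k%:R * pi = 2 * enorm (eta 0)); last by rewrite wk; ring.
      rewrite (_ : _ * _ = enorm (xi 0) ^+ 2); last by field.
      by rewrite sqrtr_sqr ger0_norm ?enorm_ge0.
have [z10|/eqP z1_neq0] := eqVneq z1 0.
  have xz := line z10; exists (fun=> x1), (fun=> 0); split.
  - exact: line_Hamilton xz.
  - by have [-> _] := xz 0 a01; rewrite scale0r.
  - by have [_ ->] := xz 0 a01.
  - by have [-> _] := xz 1 b01; rewrite scale1r.
  - by have [_ ->] := xz 1 b01.
have [eta0 [xi0 [xz xcase x0case]]] := curve z1_neq0.
move/eqP in z1_neq0; have nz0 : enorm z1 != 0 by rewrite enorm_eq0.
have nz_gt0 : 0 < enorm z1 by rewrite enorm_gt0.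
(* What remains is that the parameters given by (a) or (b) send the closed-form geodesic to the
   prescribed endpoint. *)
suff [e0 xE zE] : [/\ eta0 != 0, geodesic_x (hbracket b) eta0 xi0 1 = x1 &
    geodesic_z eta0 xi0 1 = z1].
  have w0 : enorm eta0 != 0 by rewrite enorm_eq0.
  have {}xz t : 0 <= t <= 1 ->
      x t = geodesic_x (hbracket b) eta0 xi0 t /\ z t = geodesic_z eta0 xi0 t.
    by move=> /xz; rewrite (geodesic_x_expmx hB).
  do 2 eexists; split; first exact: geodesic_Hamilton e0 xz.
  - by have [-> _] := xz 0 a01; rewrite geodesic_x0.
  - by have [_ ->] := xz 0 a01; rewrite geodesic_z0.
  - by have [-> _] := xz 1 b01.
  - by have [_ ->] := xz 1 b01.
have [x10|/eqP x1_neq0] := eqVneq x1 0.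
  have [k [k0 etaE xiE]] := x0case x10.
  have k_gt0 : 0 < k%:R :> R by rewrite ltr0n.
  have wE : enorm eta0 = 2 * pi * k%:R.
    rewrite etaE enormZ ger0_norm ?divfK// divr_ge0 ?ltW//.
    by rewrite !mulr_gt0// pi_gt0.
  have e0 : eta0 != 0 by rewrite -enorm_gt0 wE !mulr_gt0// pi_gt0.
  have c1 : cos (enorm eta0) = 1.
    by rewrite wE -[RHS](cos_2_mulrz_pi k) -pmulrn; congr cos; ring.
  have s0 : sin (enorm eta0) = 0 by apply: cos1sin0; rewrite c1 normr1.
  split=> //.
    by rewrite x10; apply/eqP; rewrite -[_ == _]negbK (geodesic_x1_neq0 hB)// c1 eqxx.
  have xi2 : enorm xi0 ^+ 2 = 2 * enorm eta0 * enorm z1.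
    rewrite xiE sqr_sqrtr; first by rewrite wE; ring.
    by rewrite ltW// !mulr_gt0// pi_gt0.
  rewrite /geodesic_z mulr1 s0 subr0 xi2 [X in _ *: X]etaE scalerA -wE.
  by rewrite -[RHS]scale1r; congr (_ *: _); field; rewrite nz0 enorm_eq0 e0.
have [theta [_ nuE etaE U xiE]] := xcase x1_neq0; move/eqP in x1_neq0.
have nx0 : enorm x1 != 0 by rewrite enorm_eq0.
(* Both norms are positive, hence so is nu(theta); theta > 0 then yields |eta0| = 2 theta without
   absolute value. *)
have [theta_gt0 c1] : 0 < theta /\ cos (2 * theta) != 1.
  by apply: nu_gt0; rewrite nuE divr_gt0 ?mulr_gt0 ?exprn_gt0// enorm_gt0.
have wE : enorm eta0 = 2 * theta.
  by rewrite etaE enormZ ger0_norm ?divfK// divr_ge0 ?ltW// mulr_gt0.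
have e0 : eta0 != 0 by rewrite -enorm_gt0 wE mulr_gt0.
have w0 : enorm eta0 != 0 by rewrite enorm_eq0.
have xE : geodesic_x (hbracket b) eta0 xi0 1 = x1.
  have := mul_Jmx_expmx_xi0 hB xi0 e0.
  rewrite {1}xiE -scalemxAr mulKVmx// => /scalerI ->//.
  by rewrite oppr_eq0 sqrf_eq0.
split=> //.
have xi0_neq0 : xi0 != 0.
  by have := x1_neq0; rewrite -xE (geodesic_x1_neq0 hB)// => /andP[].
(* Since x(1) is already matched, equality of the nu values forces the norms of the z-endpoints to
   agree; their common direction, that of eta0, then gives equality. *)
have zE : enorm (geodesic_z eta0 xi0 1) = enorm z1.
  have := nuE; rewrite (_ : theta = enorm eta0 / 2); last by rewrite wE; field.
  rewrite (nu_geodesic hB e0 (xi0 := xi0)) xE//.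
  have d0 : (enorm x1 ^+ 2)^-1 != 0 by rewrite invr_eq0 sqrf_eq0.
  by move=> /(mulIf d0)/mulfI; apply; rewrite pnatr_eq0.
have := geodesic_eta0 e0 xi0_neq0; rewrite zE {1}etaE -wE => /scalerI H.
apply/esym/H.
by rewrite mulf_neq0// invr_eq0.
Qed.
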